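(* Let $\hat f:[0,1)\to\mathbb{R}$ be a nonzero uniformly continuous function computed by some WFA over $\Sigma=\{0,1\}$ (that is, $\hat f=\hat f_{\mathcal{A}}$ for some WFA $\mathcal{A}$). Then $\hat f$ is also computed by a minimal, average preserving WFA over $\{0,1\}$ with transition matrices of the form $$A_i=\begin{pmatrix} B_i & \mathbf{b}_i\\ \mathbf{0} & 1\end{pmatrix},\quad i=0,1,$$ where $\mathbf{b}_i$ are column vectors, $\mathbf{0}$ is a zero row vector, and $\{B_0,B_1\}$ is a stable set of square matrices.
   Context: Words are over $\Sigma=\{0,1\}$: $\Sigma^*$ is the set of finite words, $\Sigma^\omega$ the set of infinite words; $\mathrm{pref}_k(w)$ is the length-$k$ prefix of $w$. For matrices $A_0,A_1$ and $v=v_1\cdots v_k$, $A_v=A_{v_1}\cdots A_{v_k}$ (identity if $v$ is empty). A set $\{B_0,B_1\}$ of square matrices of the same size is stable if $\lim_{k\to\infty}B_{\mathrm{pref}_k(w)}=0$ for every $w\in\Sigma^\omega$. A WFA $\mathcal{A}$ over $\Sigma$ with $n\ge0$ states consists of an initial distribution $I\in\mathbb{R}^{1\times n}$, a final distribution $F\in\mathbb{R}^{n\times1}$ and transition matrices $A_0,A_1\in\mathbb{R}^{n\times n}$; its $\omega$-function is $f_{\mathcal{A}}(w)=\lim_{k\to\infty}IA_{\mathrm{pref}_k(w)}F$, undefined where the limit does not exist. It is average preserving if $A_0F+A_1F=2F$. It is minimal if $\dim\langle IA_u:u\in\Sigma^*\rangle=n$ and $\dim\langle A_uF:u\in\Sigma^*\rangle=n$.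 For $w\in\Sigma^\omega$ put $num(w)=\sum_{i\ge1}w_i2^{-i}$, and let $\Omega=\Sigma^\omega\setminus\Sigma^*1^\omega$. Then $num|_\Omega:\Omega\to[0,1)$ is a bijection with inverse $bin$. The real function computed by $\mathcal{A}$ is the (a priori partial) function $\hat f_{\mathcal{A}}(x)=f_{\mathcal{A}}(bin(x))$, $x\in[0,1)$. *)

(* Defs.v *)
From HB Require Import structures.
From mathcomp Require Import all_boot all_order all_algebra.
From mathcomp Require Import all_classical all_reals all_analysis.
From mathcomp Require Import lra.

Set Implicit Arguments.
Unset Strict Implicit.
Unset Printing Implicit Defensive.

Import Order.TTheory GRing.Theory Num.Theory.
Import numFieldNormedType.Exports.

Local Open Scope classical_set_scope.
Local Open Scope ring_scope.

(* The alphabet {0,1} is bool (0 is false, 1 is true). Indices start at 0: the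
   infinite word w_1 w_2 ... is the function i |-> w_(i+1). *)
Notation word := (seq bool).
Notation iword := (nat -> bool).

Definition pref (k : nat) (w : iword) : word := mkseq w k.

Definition mxword (R : realType) n (A : bool -> 'M[R]_n) (v : word) : 'M[R]_n :=
  \big[mulmx/1%:M]_(a <- v) A a.

(* Convergence in the product topology, i.e., entrywise. *)
Definition stable (R : realType) n (B : bool -> 'M[R]_n) : Prop :=
  forall w : iword, mxword B (pref k w) @[k --> \oo] --> (0 : 'M[R]_n).

Record wfa (R : realType) (n : nat) := Wfa {
  init : 'rV[R]_n;
  final : 'cV[R]_n;
  trans : bool -> 'M[R]_n
}.

Definition approx (R : realType) n (A : wfa R n) (w : iword) (k : nat) : R :=
  (init A *m mxword (trans A) (pref k w) *m final A) 0 0.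

(* The omega-function of A as a functional relation, as it is only partially
   defined: its value at w exists and equals l. *)
Definition omega_fun (R : realType) n (A : wfa R n) (w : iword) (l : R) : Prop :=
  approx A w @ \oo --> l.

Definition average_preserving (R : realType) n (A : wfa R n) : Prop :=
  trans A false *m final A + trans A true *m final A = 2 *: final A.

Definition is_span (R : realType) (V : vectType R) (S : set V)
    (U : {vspace V}) : Prop :=
  (forall v, S v -> v \in U) /\
  (forall W : {vspace V}, (forall v, S v -> v \in W) -> (U <= W)%VS).

(* The linear span of a possibly infinite set of vectors, for which the library
   has no notion; by is_span_lspan the default value 0 is never used. *)
Definition lspan (R : realType) (V : vectType R) (S : set V) : {vspace V} :=
  xget 0%VS (is_span S).

Lemma is_span_lspan (R : realType) (V : vectType R) (S : set V) :
  is_span S (lspan S).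
Proof.
suff [U HU] : exists U, is_span S U by apply: (xgetPex _ (ex_intro _ U HU)).
pose P d := `[< exists s : seq V, (forall v, v \in s -> S v) /\ \dim (span s) = d >].
have P0 : exists d, P d.
  by exists (\dim (span ([::] : seq V))); apply/asboolP; exists [::].
have Pub d : P d -> (d <= \dim (fullv : {vspace V}))%N.
  by move=> /asboolP[s [_ <-]]; exact/dimvS/subvf.
case: (ex_maxnP P0 Pub) => d /asboolP[s [sS sd]] dmax.
exists (span s); split=> [v Sv|W HW]; last first.
  by apply/span_subvP => v vs; apply/HW/sS.
have /dmax : P (\dim (span (v :: s))).
  apply/asboolP; exists (v :: s); split=> // u.
  by rewrite inE => /predU1P[->//|/sS].
rewrite -sd span_cons => le_dim.
have /eqP -> : (span s == <[v]> + span s)%VS by rewrite eqEdim addvSr.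
by apply/(subvP (addvSl _ _))/memv_line.
Qed.

Definition minimal (R : realType) n (A : wfa R n) : Prop :=
  \dim (lspan [set init A *m mxword (trans A) u | u in [set: word]]) = n /\
  \dim (lspan [set mxword (trans A) u *m final A | u in [set: word]]) = n.

Definition num (R : realType) (w : iword) : R :=
  limn (series (fun i => (w i)%:R / 2 ^+ i.+1 : R)).

(* As a function on nat, nth true u is the infinite word u111... *)
Definition Omega : set iword := ~` range (nth true).

Section num_bij.
Variable R : realType.
Implicit Types (w : iword) (x : R).

Let shift w : iword := fun i => w i.+1.
Let term w (i : nat) : R := (w i)%:R / 2 ^+ i.+1.

Let seriesSE (u : R ^nat) n : series u n.+1 = series u n + u n.
Proof. by rewrite /series /= big_nat_recr. Qed.

Let term_ge0 w i : 0 <= term w i.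
Proof. by rewrite /term divr_ge0// exprn_ge0. Qed.

Let series_le1 w n : series (term w) n <= 1.
Proof.
suff h : series (term w) n <= 1 - (2^-1) ^+ n.
  by apply: (le_trans h); rewrite lerBlDr lerDl exprn_ge0// invr_ge0.
elim: n => [|n IH]; first by rewrite /series /= big_geq// expr0 subrr.
rewrite seriesSE.
have : term w n <= 2^-1 * 2^-1 ^+ n.
  rewrite -exprS /term -exprVn ler_piMl ?exprn_ge0 ?invr_ge0//.
  by case: (w n); rewrite ?ler01.
by move: IH; rewrite exprS; lra.
Qed.

Let series_nd w : nondecreasing_seq (series (term w)).
Proof. by apply: nondecreasing_series => i _ _; exact: term_ge0. Qed.

Let is_cvg_num w : cvgn (series (term w)).
Proof.
apply: nondecreasing_is_cvgn; first exact: series_nd.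
by exists 1 => _ [n _ <-]; exact: series_le1.
Qed.

Let num_ge0 w : 0 <= num R w.
Proof.
have := nondecreasing_cvgn_le (@series_nd w) (@is_cvg_num w) 0%N.
by rewrite /series /= big_geq.
Qed.

Let num_le1 w : num R w <= 1.
Proof. by apply: limr_le; [exact: is_cvg_num|near=> n; exact: series_le1].
Unshelve. all: by end_near. Qed.

Let numE w : num R w = ((w 0%N)%:R + num R (shift w)) / 2.
Proof.
apply/cvg_lim => //; rewrite -cvg_shiftS /=.
have -> : (fun n => series (term w) n.+1) =
    (fun n => ((w 0%N)%:R + series (term (shift w)) n) / 2).
  apply/funext => n; rewrite /series /= big_nat_recl//= mulrDl.
  rewrite mulr_suml /term expr1; congr (_ + _); apply: eq_bigr => i _.
  by rewrite /shift exprSr invfM mulrA.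
apply: cvgM; last exact: cvg_cst.
by apply: cvgD; [exact: cvg_cst|exact: is_cvg_num].
Qed.

Let Omega_shift w : Omega w -> Omega (shift w).
Proof.
move=> + [u _ uw]; apply; exists (w 0%N :: u) => //.
by apply/funext => -[|i] //=; rewrite uw.
Qed.

Let num_lt1 w : Omega w -> num R w < 1.
Proof.
move=> wO; have [N wN] : exists N, w N = false.
  apply: contrapT => /forallNP nw; apply: wO; exists [::] => //.
  by apply/funext => i; rewrite nth_nil; case: (w i) (nw i).
elim: N w {wO} wN => [|N IH] w wN; rewrite numE.
  by rewrite wN /=; have := num_le1 (shift w); lra.
have := IH (shift w) wN; case: (w 0%N) => /=; lra.
Qed.

Let num_inj : {in Omega &, injective (num R)}.
Proof.
have aux w w' : Omega w -> Omega w' -> num R w = num R w' -> w 0%N -> w' 0%N.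
  move=> wO wO'; rewrite (numE w) (numE w') => + w0; rewrite w0.
  case: (w' 0%N) => //=.
  have := num_ge0 (shift w); have := num_lt1 (Omega_shift wO'); lra.
move=> w w'; rewrite !inE => wO wO' ww'; apply/funext => n.
elim: n w w' wO wO' ww' => [|n IH] w w' wO wO' ww'.
  by apply/idP/idP; apply: aux.
apply: (IH (shift w) (shift w')); [exact: Omega_shift|exact: Omega_shift|].
have w0 : w 0%N = w' 0%N by apply/idP/idP; apply: aux.
by move: ww'; rewrite (numE w) (numE w') w0; lra.
Qed.

Let dbl x : R := if 1 / 2 <= x then 2 * x - 1 else 2 * x.
Let orb x : iword := fun i => 1 / 2 <= iter i dbl x.

Let dbl01 x : 0 <= x < 1 -> 0 <= dbl x < 1.
Proof. by rewrite /dbl; case: ifPn; rewrite -?ltNge; lra. Qed.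

Let iter01 x n : 0 <= x < 1 -> 0 <= iter n dbl x < 1.
Proof. by move=> x01; elim: n => //= n; exact: dbl01. Qed.

Let orbS x : shift (orb x) = orb (dbl x).
Proof. by apply/funext => i; rewrite /shift /orb iterSr. Qed.

Let series_orb x n : series (term (orb x)) n = x - iter n dbl x / 2 ^+ n.
Proof.
elim: n => [|n IH].
  by rewrite /series /= big_geq// expr0 divr1 subrr.
rewrite seriesSE IH iterS /term /orb; set y := iter n dbl x.
have h : (2 ^+ n.+1 : R)^-1 = 2^-1 * (2 ^+ n)^-1 by rewrite exprS invfM.
by rewrite h /dbl; case: ifPn => /= _; lra.
Qed.

Let num_orb x : 0 <= x < 1 -> num R (orb x) = x.
Proof.
move=> x01; apply/cvg_lim => //.
rewrite (_ : series _ = fun n => x - iter n dbl x / 2 ^+ n); last first.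
  by apply/funext => n; exact: series_orb.
rewrite -[X in _ --> X]subr0; apply: cvgB; first exact: cvg_cst.
apply: (@squeeze_cvgr _ _ _ _ (cst 0) (fun n => 2^-1 ^+ n)).
- near=> n; have := iter01 n x01; have : 0 < (2^-1 : R) ^+ n by rewrite exprn_gt0.
  by rewrite -exprVn /cst; nra.
- exact: cvg_cst.
- by apply: cvg_expr; rewrite ger0_norm; lra.
Unshelve. all: by end_near. Qed.

Let orb_Omega x : 0 <= x < 1 -> Omega (orb x).
Proof.
move=> x01 [u _]; elim: u x x01 => [|a u IH] x x01 uw.
  have : num R (nth true [::]) = 1.
    have sh : shift (nth true [::]) = nth true [::].
      by apply/funext => i; rewrite /shift !nth_nil.
    by have := numE (nth true [::]); rewrite sh nth_nil /=; lra.
  by rewrite uw num_orb//; lra.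
by apply: (IH (dbl x)); [exact: dbl01|rewrite -orbS -uw].
Qed.

Lemma num_bij : set_bij Omega `[0, 1[ (num R).
Proof.
split; last 1 first.
- move=> x; rewrite /= in_itv /= => x01.
  by exists (orb x); [exact: orb_Omega|exact: num_orb].
- by move=> w wO; rewrite /= in_itv /= num_ge0 num_lt1.
- exact: num_inj.
Qed.

End num_bij.

(* The inverse of num restricted to Omega; by num_bij the default value is never
   used on [0,1). *)
Definition bin (R : realType) (x : R) : iword :=
  'pinv_(fun=> xpred0) Omega (@num R) x.

(* Only the restriction of f to [0,1) matters: it is required to be the (hence
   total) real function computed by A. *)
Definition computes (R : realType) n (A : wfa R n) (f : R -> R) : Prop :=
  forall x, x \in `[0, 1[ -> omega_fun A (bin x) (f x).

Lemma unif_continuous_subspaceP (R : realType) (D : set R) (f : R -> R) :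
  unif_continuous (f : subspace D -> R) <->
  forall e : R, 0 < e -> exists2 d : R, 0 < d &
    forall x y, D x -> D y -> `|x - y| < d -> `|f x - f y| < e.
Proof.
split=> [fu e e0|fu E].
  have /fu : entourage [set xy : R * R | `|xy.1 - xy.2| < e].
    by rewrite -entourage_ballE; exists e.
  move=> [W]; rewrite -entourage_ballE => -[d /= d0 dW] WE.
  exists d => // x y Dx Dy xyd.
  by apply: (WE (x, y)); right; do !split=> //; exact: dW.
rewrite -entourage_ballE => -[e /= e0 eE].
have [d d0 fd] := fu _ e0.
exists [set xy | `|xy.1 - xy.2| < d]; first by rewrite -entourage_ballE; exists d.
move=> [x y] /= [->|[Dx [Dy xyd]]]; apply: eE; last exact: fd.
exact: ballxx.
Qed.

(* Main.v *)
(* Write f_u(x) = f(0.u + 2^-|u| x). If A computes f, then f_u(x) is the limit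
   of (I A_u)(A_v F) over the prefixes v of bin(x), so the infinite matrix
   f_u(x), indexed by words u and points x, has rank at most the number of
   states of A. An invertible minor of maximal size gives words u_i such that
   the f_(u_i) are a basis of the span of all f_u, points x_j separating that
   span, and transition matrices acting on the basis by
   phi(x) |-> phi((a + x) / 2).
   By uniform continuity f_v is nearly constant when v is long; as f is nonzero,
   the constant 1 lies in the (finite-dimensional) span, with coordinate row e,
   and A_v - phi(0.v) e -> 0 as |v| -> oo. Taking 1 as the last basis element
   gives the block form; the limit gives stability of B, and hence
   invertibility of 1 - (B_0 + B_1) / 2. The final vector is then the one fixed
   by (A_0 + A_1) / 2 and normalized by e F = 1, and for v running over the
   prefixes of bin(x) one has A_v F -> phi(x), which yields both f(x) and
   minimality. *)
Require Import Defs.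
From HB Require Import structures.
From mathcomp Require Import all_boot all_order all_algebra.
From mathcomp Require Import all_classical all_reals all_analysis.
From mathcomp Require Import lra.

Set Implicit Arguments.
Unset Strict Implicit.
Unset Printing Implicit Defensive.

Import Order.TTheory GRing.Theory Num.Theory.
Import numFieldNormedType.Exports.

Local Open Scope classical_set_scope.
Local Open Scope ring_scope.

(** * Limits of matrices *)

Lemma cvg_mxP {R : realType} {T : Type} {F : set_system T} {FF : Filter F}
    m n (M : T -> 'M[R]_(m, n)) (L : 'M[R]_(m, n)) :
  M x @[x --> F] --> L <->
  forall i j, M x i j @[x --> F] --> L i j.
Proof.
split=> [ML i j|ML].
  by apply: (@cvg_comp _ _ _ M (fun N => N i j)); [exact: ML|exact: coord_continuous].
move=> P [Q QL QP]; rewrite nbhs_simpl /=.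
have : \forall x \near F, forall i j, Q i j (M x i j).
  by apply: filter_forall => i; apply: filter_forall => j; exact: ML (QL i j).
by apply: filterS => x; exact: QP.
Qed.

Lemma cvg_mulmx {R : realType} {T : Type} {F : set_system T} {FF : Filter F}
    m n p (M : T -> 'M[R]_(m, n)) (N : T -> 'M[R]_(n, p))
    (K : 'M[R]_(m, n)) (L : 'M[R]_(n, p)) :
  M x @[x --> F] --> K -> N x @[x --> F] --> L ->
  M x *m N x @[x --> F] --> K *m L.
Proof.
move=> /cvg_mxP MK /cvg_mxP NL; apply/cvg_mxP => i j.
rewrite mxE (_ : (fun x => _) = fun x => \sum_k M x i k * N x k j); last first.
  by apply/funext => x; rewrite mxE.
by apply: cvg_big => [|k _]; [exact: add_continuous|exact: cvgM].
Qed.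

(** * Binary expansions and dyadic affine maps *)

Section binary_expansion.
Variable R : realType.
Implicit Types (w : iword) (x y : R) (u v : word).

Lemma size_pref k w : size (pref k w) = k.
Proof. exact: size_mkseq. Qed.

Definition consw (a : bool) w : iword := fun i => if i is j.+1 then w j else a.

Lemma pref_consw k a w : pref k.+1 (consw a w) = a :: pref k w.
Proof.
by rewrite /pref /mkseq /= -[1%N]addn0 iotaDl -map_comp.
Qed.

Lemma consw_eta w : w = consw (w 0%N) (w \o succn).
Proof. by apply/funext => -[]. Qed.

Lemma Omega_consw a w : Omega (consw a w) <-> Omega w.
Proof.
split=> wO [u _ uw]; apply: wO.
  exists (a :: u) => //; apply/funext => -[|i] //=; by rewrite uw.
exists (behead u) => //; apply/funext => i.
by rewrite nth_behead uw.
Qed.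

Lemma num_consw a w : Defs.num R (consw a w) = (a%:R + Defs.num R w) / 2.
Proof.
apply/cvg_lim => //; rewrite -cvg_shiftS /=.
have -> : (fun n => series (fun i => (consw a w i)%:R / 2 ^+ i.+1 : R) n.+1) =
    (fun n => (a%:R + series (fun i => (w i)%:R / 2 ^+ i.+1 : R) n) / 2).
  apply/funext => n; rewrite /series /= big_nat_recl//= expr1 mulrDl mulr_suml.
  by congr (_ + _); apply: eq_bigr => i _; rewrite -mulrA -invfM -exprSr.
apply: cvgM; last exact: cvg_cst.
apply: cvgD; first exact: cvg_cst.
apply: (@series_le_cvg _ _ (geometric 2^-1 2^-1)) => [n|n|n|].
- by rewrite divr_ge0// exprn_ge0.
- by rewrite /= mulr_ge0// exprn_ge0.
- rewrite /= -exprVn exprS ler_piMl// ?mulr_ge0 ?exprn_ge0//.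
  by case: (w n); rewrite ?lexx ?ler01.
- by apply: is_cvg_geometric_series; rewrite ger0_norm; lra.
Qed.

Lemma num_itv w : Omega w -> 0 <= Defs.num R w < 1.
Proof. by have [+ _ _] := num_bij R => /(_ w) /[apply]; rewrite /= in_itv. Qed.

Lemma bin_num w : Omega w -> bin (Defs.num R w) = w.
Proof.
by have [_ inj _] := num_bij R => wO; apply: pinvKV => //; exact: mem_set.
Qed.

Lemma bin_Omega x : 0 <= x < 1 -> Omega (bin x) /\ Defs.num R (bin x) = x.
Proof.
move=> x01; have [_ _ /(_ x)] := num_bij R.
by rewrite /= in_itv /= => /(_ x01)[w wO <-]; rewrite bin_num.
Qed.

(** The point 0.v + 2^-|v| x. *)
Definition prepend v x : R := foldr (fun (a : bool) y => (a%:R + y) / 2) x v.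

Lemma prepend_cat u v x : prepend (u ++ v) x = prepend u (prepend v x).
Proof. by rewrite /prepend foldr_cat. Qed.

Lemma prepend_itv v x : 0 <= x < 1 -> 0 <= prepend v x < 1.
Proof. by move=> x01; elim: v => //= -[] v /=; lra. Qed.

Lemma prependB v x y : prepend v x - prepend v y = (x - y) / 2 ^+ size v.
Proof.
elim: v => [|a v IH] /=; first by rewrite expr0 divr1.
rewrite exprSr invfM mulrA -IH; lra.
Qed.

Lemma bin_prepend v x k : 0 <= x < 1 ->
  pref (size v + k) (bin (prepend v x)) = v ++ pref k (bin x).
Proof.
move=> x01; elim: v => [//|a v IH].
have [wO nx] := bin_Omega (prepend_itv v x01).
(* Adding a letter in front stays in [Omega], where [bin] inverts [num]. *)
have -> : bin (prepend (a :: v) x) = consw a (bin (prepend v x)).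
  by rewrite /= -[in LHS]nx -num_consw bin_num//; apply/Omega_consw.
by rewrite addSn pref_consw IH.
Qed.

(** The witness y is the number whose expansion is what remains of [bin x] after k letters. *)
Lemma prepend_bin k x : 0 <= x < 1 ->
  exists2 y, 0 <= y < 1 & x = prepend (pref k (bin x)) y.
Proof.
elim: k x => [|k IH] x x01; first by exists x.
have [] := bin_Omega x01; rewrite (consw_eta (bin x)) pref_consw.
move: (bin x 0%N) (bin x \o succn) => a w /Omega_consw wO <-.
have [y y01 ny] := IH _ (num_itv wO).
by exists y => //; rewrite num_consw {1}ny bin_num.
Qed.

End binary_expansion.

(** * Limits over long words and matrix products *)

(* Limits along this filter are uniform over the words of a given length. *)
Definition long_words : set_system word :=
  filter_from [set: nat] (fun K => [set v | (K <= size v)%N]).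

#[global] Instance long_words_filter : ProperFilter long_words.
Proof.
apply: filter_from_proper => [|K _]; last by exists (nseq K true); rewrite /= size_nseq.
apply: filter_from_filter => [|K L _ _]; first by exists 0%N.
by exists (maxn K L) => // v /=; rewrite geq_max => /andP[].
Qed.

Lemma pref_long_words w : pref k w @[k --> \oo] --> long_words.
Proof.
move=> P [K _ KP]; exists K => // k /= Kk.
by apply: KP; rewrite /= size_pref.
Qed.

Section words.
Variables (R : realType) (n : nat) (A : bool -> 'M[R]_n).

Lemma mxword_nil : mxword A [::] = 1%:M.
Proof. by rewrite /mxword big_nil. Qed.

Lemma mxword_cons a v : mxword A (a :: v) = A a *m mxword A v.
Proof. by rewrite /mxword big_cons. Qed.

Lemma mxword_cat u v : mxword A (u ++ v) = mxword A u *m mxword A v.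
Proof.
elim: u => [|a u IH]; first by rewrite mxword_nil mul1mx.
by rewrite cat_cons !mxword_cons IH mulmxA.
Qed.

Lemma mxword_conj (S : 'M[R]_n) v : S \in unitmx ->
  mxword (fun a => S *m A a *m invmx S) v = S *m mxword A v *m invmx S.
Proof.
move=> Su; elim: v => [|a v IH].
  by rewrite /mxword !big_nil mulmx1 mulmxV.
by rewrite /mxword !big_cons -/(mxword _ _) IH !mulmxA mulmxKV.
Qed.

End words.

(** * Oscillation on dyadic intervals *)

Definition eval_mx (R : realType) p m (phi : R -> 'cV[R]_p) (x : 'I_m -> R) :
  'M[R]_(p, m) := \matrix_(i, j) phi (x j) i 0.

Lemma mul_eval_mx (R : realType) p q m (phi : R -> 'cV[R]_p) (x : 'I_m -> R)
    (M : 'M[R]_(q, p)) :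
  M *m eval_mx phi x = eval_mx (fun y => M *m phi y) x.
Proof.
by apply/matrixP => i j; rewrite !mxE; apply: eq_bigr => k _; rewrite mxE.
Qed.

(** Ranging over all choices of two points per word replaces a supremum over the dyadic interval of
    v. *)
Definition vanishing_osc (R : realType) p (phi : R -> 'cV[R]_p) : Prop :=
  forall x y : word -> R,
    (forall v, 0 <= x v < 1) -> (forall v, 0 <= y v < 1) ->
    phi (prepend v (x v)) - phi (prepend v (y v)) @[v --> long_words] --> (0 : 'cV[R]_p).

(** The two points are less than 2^-|uv| apart. The fixed prefix u serves the basis functions
    f_(u_i). *)
Lemma unif_continuous_osc (R : realType) (f : R -> R) :
  unif_continuous (f : subspace `[0, 1[%classic -> R) ->
  forall u (x y : word -> R),
    (forall v, 0 <= x v < 1) -> (forall v, 0 <= y v < 1) ->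
    f (prepend (u ++ v) (x v)) - f (prepend (u ++ v) (y v))
      @[v --> long_words] --> (0 : R).
Proof.
move=> /unif_continuous_subspaceP fu u x y x01 y01.
apply/cvgr0Pnorm_lt => e /fu[d d0 fd].
have : 2^-1 ^+ n @[n --> \oo] --> (0 : R).
  by apply: cvg_expr; rewrite ger0_norm; lra.
move=> /cvgr0Pnorm_lt/(_ _ d0)[K _ Kd]; exists K => // v /= Kv.
apply: fd; [by rewrite /= in_itv /= prepend_itv..|].
rewrite prependB normrM -exprVn.
have /Kd : (K <= size (u ++ v))%N by rewrite size_cat (leq_trans Kv)// leq_addl.
apply: le_lt_trans; rewrite ler_piMl// ler_norml.
by move: (x01 v) (y01 v); lra.
Qed.

(** * Rank of the Hankel matrix *)

Section hankel.
Variables (R : realType) (f : R -> R) (n : nat) (A : wfa R n).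
Hypothesis Af : computes A f.

(** Columns are indexed by points, that is infinite suffixes, instead of the usual finite
    suffixes. *)
Definition hankel m (u : 'I_m -> word) (x : 'I_m -> R) : 'M[R]_m :=
  \matrix_(i, j) f (prepend (u i) (x j)).

Lemma computes_prepend u x : 0 <= x < 1 ->
  (init A *m mxword (trans A) u *m
    (mxword (trans A) (pref k (bin x)) *m final A)) 0 0 @[k --> \oo]
  --> f (prepend u x).
Proof.
move=> x01; have := Af (x := prepend u x).
rewrite in_itv /= prepend_itv// => /(_ isT).
(* After the first |u| terms, every prefix splits as u followed by a prefix of [bin x]. *)
move/(cvg_comp _ _ (cvg_addnl (size u))); apply: cvg_trans.
apply: near_eq_cvg; near=> k.
by rewrite /= /Defs.approx bin_prepend// mxword_cat !mulmxA.
Unshelve. all: by end_near. Qed.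

(** The matrix is a limit of products [P *m Q k] of inner dimension n < m with a common left factor,
    so a nonzero row killing P also kills the limit. *)
Lemma hankel_notin_unitmx m (u : 'I_m -> word) (x : 'I_m -> R) :
  (forall j, 0 <= x j < 1) -> (n < m)%N -> hankel u x \notin unitmx.
Proof.
move=> x01 nm.
pose P := \matrix_i (init A *m mxword (trans A) (u i)).
have /rowV0Pn[c /sub_kermxP cP c0] : kermx P != 0.
  rewrite kermx_eq0; apply/negP => /eqP Pm.
  by have := rank_leq_col P; rewrite Pm leqNgt nm.
pose Q k := \matrix_(a, j) (mxword (trans A) (pref k (bin (x j))) *m final A) a 0.
have PQ : P *m Q k @[k --> \oo] --> hankel u x.
  apply/cvg_mxP => i j; have := @computes_prepend (u i) _ (x01 j); rewrite mxE.
  apply: cvg_trans; apply: near_eq_cvg; near=> k.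
  by rewrite !mxE; apply: eq_bigr => a _; rewrite !mxE.
have cH : c *m hankel u x = 0.
  apply: (@cvg_unique _ _ ((fun k => c *m (P *m Q k)) @ \oo)).
  - exact: norm_hausdorff.
  - by apply: cvg_mulmx => //; exact: cvg_cst.
  - rewrite (_ : (fun k => _) = fun=> 0); first exact: cvg_cst.
    by apply/funext => k; rewrite mulmxA cP mul0mx.
apply/negP => Hu; move/eqP: c0; apply.
by rewrite -(mulmxK Hu c) cH mul0mx.
Unshelve. all: by end_near. Qed.

(* Bordering an invertible minor of maximal size by the row of v and the column
   of y gives a singular matrix, whose Schur complement therefore vanishes. *)
Lemma hankel_factor : exists m (u : 'I_m -> word) (x : 'I_m -> R),
  [/\ forall j, 0 <= x j < 1, hankel u x \in unitmx &
    forall v y, 0 <= y < 1 -> (f (prepend v y))%:M =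
      (\row_j f (prepend v (x j))) *m invmx (hankel u x) *m
        \col_i f (prepend (u i) y) ].
Proof.
pose P m := `[< exists (u : 'I_m -> word) (x : 'I_m -> R),
  (forall j, 0 <= x j < 1) /\ hankel u x \in unitmx >].
have P0 : exists m, P m.
  (* The empty minor has determinant 1. *)
  exists 0%N; apply/asboolP; exists (fun=> [::]), (fun=> 0); split; first by case.
  by rewrite unitmxE det_mx00 unitr1.
have Pn m : P m -> (m <= n)%N.
  move=> /asboolP[u [x [x01 Hu]]]; rewrite leqNgt; apply/negP => nm.
  by move: Hu; apply/negP/hankel_notin_unitmx.
case: (ex_maxnP P0 Pn) => m /asboolP[u [x [x01 Hu]]] mmax.
exists m, u, x; split=> // v y y01.
set r := \row_j _; set c := \col_i _; set G := hankel u x.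
pose u' (i : 'I_(m + 1)) := if fintype.split i is inl k then u k else v.
pose x' (i : 'I_(m + 1)) := if fintype.split i is inl k then x k else y.
have H'E : hankel u' x' = block_mx G c r (f (prepend v y))%:M.
  apply/matrixP => i j; rewrite !mxE /u' /x'.
  case: (fintype.split i) => k; rewrite !mxE; case: (fintype.split j) => l; rewrite !mxE //.
  by rewrite !ord1 eqxx mulr1n.
have H'u : hankel u' x' \notin unitmx.
  apply/negP => H'u; have /mmax : P (m + 1)%N.
    apply/asboolP; exists u', x'; split=> // j.
    by rewrite /x'; case: (fintype.split j).
  by rewrite addn1 ltnn.
have : block_mx 1%:M 0 (- (r *m invmx G)) 1%:M *m hankel u' x' =
    block_mx G c 0 ((f (prepend v y))%:M - r *m invmx G *m c).
  rewrite H'E mulmx_block !mul1mx !mul0mx !addr0 !mulNmx mulmxKV// addNr.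
  by rewrite addrC.
move/(congr1 determinant); rewrite det_mulmx det_lblock !det1 !mul1r det_ublock.
move=> detE; move: H'u; rewrite unitmxE detE unitrM -unitmxE Hu /= unitfE negbK.
rewrite det_mx11 => /eqP d0; apply/eqP; rewrite -subr_eq0; apply/eqP/matrixP => i j.
by rewrite !ord1 d0 mxE.
Qed.
End hankel.

(** * Realizations on a basis of functions *)

(** The entries of phi form a basis of the span of the f_u: [rz_unit] gives independence, and
    [rz_reach] is the dual form of the rows I A_u spanning the whole space. *)
Record realization (R : realType) (f : R -> R) m (phi : R -> 'cV[R]_m)
    (I : 'rV[R]_m) (A : bool -> 'M[R]_m) (x : 'I_m -> R) : Prop := Realization {
  rz_trans : forall a y, 0 <= y < 1 -> A a *m phi y = phi ((a%:R + y) / 2);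
  rz_init : forall y, 0 <= y < 1 -> I *m phi y = (f y)%:M;
  rz_itv : forall j, 0 <= x j < 1;
  rz_unit : eval_mx phi x \in unitmx;
  rz_reach : forall M : 'M[R]_m, (forall u, I *m mxword A u *m M = 0) -> M = 0;
  rz_osc : vanishing_osc phi
}.

(** The point x itself lies in the dyadic interval of each of its prefixes. *)
Lemma vanishing_osc_bin (R : realType) p (phi : R -> 'cV[R]_p) x y :
  vanishing_osc phi -> 0 <= x < 1 -> 0 <= y < 1 ->
  phi (prepend (pref k (bin x)) y) @[k --> \oo] --> phi x.
Proof.
move=> osc x01 y01.
have /choice[z zP] : forall k, exists z : R,
    0 <= z < 1 /\ x = prepend (pref k (bin x)) z.
  by move=> k; have [z] := prepend_bin k x01; exists z.
(* On the prefix of length k, [z \o size] picks [z k]. *)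
have := osc (fun=> y) (z \o size) (fun=> y01) (fun v => (zP (size v)).1).
move/(cvg_comp _ _ (@pref_long_words (bin x))) => h.
rewrite -[X in _ --> X]add0r; apply: cvg_trans (cvgD h (cvg_cst (phi x))).
apply: near_eq_cvg; near=> k.
by rewrite fctE /= size_pref -(zP k).2 subrK.
Unshelve. all: by end_near. Qed.

Section realization.
Variables (R : realType) (f : R -> R) (m : nat) (phi : R -> 'cV[R]_m)
  (I : 'rV[R]_m) (A : bool -> 'M[R]_m) (x : 'I_m -> R).
Hypothesis r : realization f phi I A x.

(* The coordinates in phi of the constant function 1, see realization_const. *)
Let e : 'rV[R]_m := const_mx 1 *m invmx (eval_mx phi x).

Lemma realization_word v y : 0 <= y < 1 ->
  mxword A v *m phi y = phi (prepend v y).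
Proof.
move=> y01; elim: v => [|a v IH]; first by rewrite mxword_nil mul1mx.
by rewrite mxword_cons -mulmxA IH (rz_trans r)// prepend_itv.
Qed.

Lemma realization_eval (M : 'M[R]_m) : M *m eval_mx phi x = 0 -> M = 0.
Proof. by move=> M0; rewrite -[M](mulmxK (rz_unit r)) M0 mul0mx. Qed.

(** Times the invertible evaluation matrix, A_v has the columns phi(0.v + 2^-|v| x_j), all close to
    phi(0.v) when v is long. *)
Lemma mxword_sub_cvg0 :
  mxword A v - phi (prepend v 0) *m e @[v --> long_words] --> (0 : 'M[R]_m).
Proof.
have -> : (fun v => mxword A v - phi (prepend v 0) *m e) =
    fun v => (eval_mx (phi \o prepend v) x - phi (prepend v 0) *m const_mx 1)
      *m invmx (eval_mx phi x).
  apply/funext => v; rewrite mulmxBl -mulmxA -/e; congr (_ - _).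
  apply: (canRL (mulmxK (rz_unit r))); rewrite mul_eval_mx.
  apply/matrixP => i j.
  rewrite [LHS]mxE [RHS]mxE realization_word//; exact: rz_itv r j.
rewrite -(mul0mx m (invmx (eval_mx phi x))).
apply: cvg_mulmx; last exact: cvg_cst.
apply/cvg_mxP => i j; rewrite mxE.
have z01 : 0 <= (0 : R) < 1 by rewrite lexx ltr01.
have /cvg_mxP/(_ i 0) := rz_osc r (fun=> rz_itv r j) (fun=> z01).
rewrite mxE; apply: cvg_trans; apply: near_eq_cvg; near=> v.
by rewrite !mxE big_ord1 !mxE mulr1.
Unshelve. all: by end_near. Qed.

Lemma mxword_pref_cvg y : 0 <= y < 1 ->
  mxword A (pref k (bin y)) @[k --> \oo] --> phi y *m e.
Proof.
move=> y01; have := mxword_sub_cvg0.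
move/(cvg_comp _ _ (@pref_long_words (bin y))) => h.
have z01 : 0 <= (0 : R) < 1 by rewrite lexx ltr01.
have h' := vanishing_osc_bin (rz_osc r) y01 z01.
have he : (fun _ : nat => e) @ \oo --> e by exact: cvg_cst.
rewrite -[X in _ --> X]add0r; apply: cvg_trans (cvgD h (cvg_mulmx h' he)).
by apply: near_eq_cvg; near=> k; rewrite fctE /= subrK.
Unshelve. all: by end_near. Qed.

Hypothesis f_nonzero : exists2 z, z \in `[0, 1[ & f z != 0.

(** Let f(z) be nonzero. Along the prefixes v of [bin z], A_v phi(y) tends both to phi(z) and to
    phi(z) e phi(y). Applying I and cancelling f(z) gives the claim. *)
Lemma realization_const y : 0 <= y < 1 -> e *m phi y = 1%:M.
Proof.
move=> y01; have [z + fz] := f_nonzero; rewrite in_itv /= => z01.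
have h1 := vanishing_osc_bin (rz_osc r) z01 y01.
have h2 : phi (prepend (pref k (bin z)) y) @[k --> \oo] --> phi z *m e *m phi y.
  have hy : (fun _ : nat => phi y) @ \oo --> phi y by exact: cvg_cst.
  apply: cvg_trans (cvg_mulmx (mxword_pref_cvg z01) hy).
  by apply: near_eq_cvg; near=> k; rewrite realization_word.
have /(congr1 (mulmx I)) : phi z = phi z *m e *m phi y.
  by apply: cvg_unique h1 h2; exact: norm_hausdorff.
rewrite -(mulmxA (phi z)) (mulmxA I) (rz_init r)// mul_scalar_mx => h.
by apply: (scalerI fz); rewrite -h scalemx1.
Unshelve. all: by end_near. Qed.

(** Both rows pair to 1 with every phi(x_j), and these columns separate rows. *)
Lemma realization_fix a : e *m A a = e.
Proof.
apply/eqP; rewrite -subr_eq0; apply/eqP.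
rewrite -[LHS](mulmxK (rz_unit r)) (_ : _ *m eval_mx _ _ = 0) ?mul0mx//.
rewrite mul_eval_mx; apply/matrixP => i j; rewrite [LHS]mxE mulmxBl -mulmxA.
have x01 := rz_itv r j.
rewrite (rz_trans r)// !realization_const ?subrr ?mxE//.
exact: (@prepend_itv _ [:: a]).
Qed.

Lemma realization_basis (S : 'M[R]_m) : S \in unitmx ->
  realization f (fun y => S *m phi y) (I *m invmx S)
    (fun a => S *m A a *m invmx S) x.
Proof.
move=> Su; split.
- by move=> a y y01; rewrite -!mulmxA mulKmx// (rz_trans r).
- by move=> y y01; rewrite -!mulmxA mulKmx// (rz_init r).
- exact: rz_itv r.
- by rewrite -mul_eval_mx unitmx_mul Su (rz_unit r).
- move=> M M0; have : invmx S *m M = 0.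
    apply: (rz_reach r) => u; have := M0 u.
    by rewrite mxword_conj// !mulmxA mulmxKV.
  by move/(congr1 (mulmx S)); rewrite mulKVmx// mulmx0.
- move=> y z y01 z01; rewrite -(mulmx0 1 S).
  under eq_cvg do rewrite -mulmxBr.
  apply: cvg_mulmx; first exact: cvg_cst.
  exact: rz_osc r _ _ y01 z01.
Qed.

End realization.

Lemma computes_realization (R : realType) (f : R -> R) n (A : wfa R n) :
  unif_continuous (f : subspace `[0, 1[%classic -> R) -> computes A f ->
  exists m phi I A' x, @realization R f m phi I A' x.
Proof.
move=> fu Af; have [m [u [x [x01 Hu fE]]]] := hankel_factor Af.
pose phi y : 'cV[R]_m := \col_i f (prepend (u i) y).
(* By [hankel_factor], [J v] is the coordinate row of f_v in the basis f_(u_i). Row i of [B a] holds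
   the coordinates of f_(u_i a), which is y |-> f_(u_i)((a + y) / 2). *)
pose J v := \row_j f (prepend v (x j)) *m invmx (hankel f u x).
pose B a := \matrix_i J (u i ++ [:: a]).
have evalE : eval_mx phi x = hankel f u x by apply/matrixP => i j; rewrite !mxE.
have B_phi a y : 0 <= y < 1 -> B a *m phi y = phi ((a%:R + y) / 2).
  move=> y01; apply/row_matrixP => i; rewrite row_mul rowK -fE//.
  by apply/matrixP => k l; rewrite prepend_cat !mxE !ord1 mulr1n.
have Bw v y : 0 <= y < 1 -> mxword B v *m phi y = phi (prepend v y).
  move=> y01; elim: v => [|a v IH]; first by rewrite mxword_nil mul1mx.
  by rewrite mxword_cons -mulmxA IH B_phi// prepend_itv.
have Jw v : J [::] *m mxword B v = J v.
  apply: (can_inj (mulmxK Hu)); rewrite mulmxKV// -evalE mul_eval_mx.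
  apply/matrixP => k j; rewrite !ord1 [LHS]mxE -mulmxA Bw//.
  by rewrite -fE ?prepend_itv// !mxE mulr1n.
exists m, phi, (J [::]), B, x; split=> //.
- by move=> y y01; rewrite -fE.
- by rewrite evalE.
(* The rows I A_(u_i) = J (u_i) are those of the identity matrix. *)
- move=> M M0; apply/row_matrixP => i; rewrite row0 -(M0 (u i)) Jw.
  rewrite -{1}[M]mul1mx row_mul -(mulmxV Hu) row_mul.
  by congr (_ *m _ *m _); apply/rowP => j; rewrite !mxE.
- move=> y z y01 z01; apply/cvg_mxP => i k; rewrite mxE.
  have := unif_continuous_osc fu (u i) y01 z01; apply: cvg_trans.
  by apply: near_eq_cvg; near=> v; rewrite !mxE !prepend_cat.
Unshelve. all: by end_near. Qed.

(** * Linear algebra: spans, averages, complements *)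

Lemma lspan_full (R : realType) (V : vectType R) (S : set V) :
  (forall g : 'End(V), (forall v, S v -> g v = 0) -> g = 0) ->
  \dim (lspan S) = \dim {:V}.
Proof.
move=> gS; have [sS _] := is_span_lspan S; set U := lspan S in sS *.
suff -> : U = fullv by [].
apply/eqP; rewrite eqEsubv subvf /=; apply/subvP => v _.
(* The test map is the identity minus the projection onto the span, which kills S. *)
have /lfunP/(_ v) : (\1 - projv U)%VF = 0.
  by apply: gS => w /sS wU; rewrite add_lfunE opp_lfunE id_lfunE projv_id// subrr.
rewrite add_lfunE opp_lfunE id_lfunE zero_lfunE => /eqP; rewrite subr_eq0 => /eqP ->.
exact: memv_proj.
Qed.

Lemma lspan_rV_full (R : realType) n (S : set 'rV[R]_n) :
  (forall M : 'M[R]_n, (forall v, S v -> v *m M = 0) -> M = 0) ->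
  \dim (lspan S) = n.
Proof.
move=> MS; rewrite lspan_full ?dimvf /dim /= ?mul1n// => g gS.
have gE v : g v = v *m lin1_mx g by rewrite mul_rV_lin1.
have g0 : lin1_mx g = 0 by apply: MS => v /gS; rewrite gE.
by apply/lfunP => v; rewrite gE g0 mulmx0 zero_lfunE.
Qed.

Lemma lspan_cV_full (R : realType) n (S : set 'cV[R]_n) :
  (forall M : 'M[R]_n, (forall v, S v -> M *m v = 0) -> M = 0) ->
  \dim (lspan S) = n.
Proof.
move=> MS; rewrite lspan_full ?dimvf /dim /= ?muln1// => g gS.
pose M : 'M[R]_n := \matrix_(i, j) g (delta_mx j 0) i 0.
have gE v : g v = M *m v.
  rewrite {1}[v]matrix_sum_delta linear_sum; apply/colP => i.
  rewrite !mxE summxE; apply: eq_bigr => j _.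
  by rewrite big_ord1 linearZ !mxE mulrC.
have M0 : M = 0 by apply: MS => v /gS; rewrite gE.
by apply/lfunP => v; rewrite gE M0 mul0mx zero_lfunE.
Qed.

(** This makes the linear equation for the upper part of the final vector solvable. *)
Lemma avg_unitmx (R : realType) m (B : bool -> 'M[R]_m) :
  mxword B v @[v --> long_words] --> (0 : 'M[R]_m) ->
  1%:M - 2^-1 *: (B false + B true) \in unitmx.
Proof.
move=> B0; rewrite -row_free_unit -kermx_eq0; apply/eqP/row_matrixP => i.
rewrite row0; set c := row i _.
have cB : c = 2^-1 *: (c *m B false + c *m B true).
  have : c *m (1%:M - 2^-1 *: (B false + B true)) = 0.
    by rewrite -row_mul mulmx_ker row0.
  by rewrite mulmxBr mulmx1 -scalemxAr mulmxDr => /eqP; rewrite subr_eq0 => /eqP.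
have cvgc : c *m mxword B v @[v --> long_words] --> (0 : 'rV[R]_m).
  by rewrite -(mulmx0 m c); apply: cvg_mulmx => //; exact: cvg_cst.
apply/eqP; rewrite -normr_le0; apply/ler_addgt0Pl => e e0; rewrite addr0.
have /cvgr0Pnorm_lt/(_ _ e0)[K _ Ke] := cvgc.
(* c is fixed by the average of the B a, hence is the average of the c B_u over
   all words u of length K. *)
suff h j : forall N : 'M[R]_m,
    (forall u, size u = j -> `|c *m mxword B u *m N| <= e) -> `|c *m N| <= e.
  by rewrite -[c]mulmx1; apply: (h K) => u uK; rewrite mulmx1 ltW// Ke//= uK.
elim: j => [|j IH] N cN.
  by have := cN [::] erefl; rewrite mxword_nil mulmx1.
(* The last letter of a word of length j + 1 is absorbed into N. *)
have cBN a : `|c *m (B a *m N)| <= e.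
  apply: IH => u uj; have := cN (rcons u a).
  rewrite size_rcons uj -cats1 mxword_cat mxword_cons mxword_nil mulmx1 !mulmxA.
  by apply.
rewrite cB -scalemxAl mulmxDl -!mulmxA normrZ ger0_norm//.
have := ler_normD (c *m (B false *m N)) (c *m (B true *m N)).
have := cBN true; have := cBN false; lra.
Qed.

(** The rows of Q are a basis of a complement of the line through e. Invertibility is stated as
    [row_full] because the matrix is not yet square by type. *)
Lemma row_complement (F : fieldType) n (e : 'rV[F]_n) : e != 0 ->
  exists m (Q : 'M[F]_(m, n)), n = (m + 1)%N /\ row_full (col_mx Q e).
Proof.
move=> e0; exists (\rank e^C), (row_base e^C%MS); split.
  by have := rank_leq_col e; rewrite mxrank_compl rank_rV e0 => /subnK.
have := addsmx_compl_full e; rewrite -!col_leq_rank => /leq_trans; apply.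
rewrite -addsmxE addsmxC; apply/mxrankS/addsmxS => //.
by rewrite eq_row_base.
Qed.

(** * The normal form *)

Section normal_form.
Variables (R : realType) (f : R -> R) (m : nat) (phi : R -> 'cV[R]_(m + 1))
  (I : 'rV[R]_(m + 1)) (A : bool -> 'M[R]_(m + 1)) (x : 'I_(m + 1) -> R).
Hypothesis r : realization f phi I A x.
Hypothesis f_nonzero : exists2 z, z \in `[0, 1[ & f z != 0.
Let e : 'rV[R]_(m + 1) := row_mx 0 1%:M.
Hypothesis eE : const_mx 1 *m invmx (eval_mx phi x) = e.

Let B a := ulsubmx (A a).
Let b a := ursubmx (A a).

(** By [realization_fix] with e = (0 1), the last row of A_a is e. *)
Let AE a : A a = block_mx (B a) (b a) 0 1%:M.
Proof.
have := realization_fix r f_nonzero a; rewrite eE -{1}[A a]vsubmxK.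
rewrite mul_row_col mul0mx mul1mx add0r => dA.
by rewrite -{1}[A a]vsubmxK dA -[usubmx (A a)]hsubmxK.
Qed.

Let mxwordE v : exists c, mxword A v = block_mx (mxword B v) c 0 1%:M.
Proof.
elim: v => [|a v [c IH]].
  by exists 0; rewrite !mxword_nil -scalar_mx_block.
exists (B a *m c + b a); rewrite !mxword_cons IH AE mulmx_block.
by rewrite !mulmx0 !mul0mx !mul1mx mulmx1 !add0r addr0.
Qed.

(** The first m entries of e vanish, so the correction phi(0.v) e leaves the upper left block of A_v
    untouched. *)
Let B_cvg0 : mxword B v @[v --> long_words] --> (0 : 'M[R]_m).
Proof.
have /cvg_mxP A0 := mxword_sub_cvg0 r.
apply/cvg_mxP => i j; have := A0 (lshift 1 i) (lshift 1 j); rewrite eE !mxE.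
apply: cvg_trans; apply: near_eq_cvg; near=> v.
have [c ->] := mxwordE v.
by rewrite [LHS]mxE block_mxEul [X in _ + X]mxE mxE big_ord1 row_mxEl mxE mulr0 subr0.
Unshelve. all: by end_near. Qed.

(** The upper part y solves y = (B_0 + B_1) y / 2 + (b_0 + b_1) / 2, which is average preservation
    when the last entry is 1. *)
Let F : 'cV[R]_(m + 1) :=
  col_mx (invmx (1%:M - 2^-1 *: (B false + B true)) *m
    (2^-1 *: (b false + b true))) 1%:M.

Let eF : e *m F = 1%:M.
Proof. by rewrite mul_row_col mul0mx mul1mx add0r. Qed.

Let AF : A false *m F + A true *m F = 2 *: F.
Proof.
rewrite !AE !mul_block_col !mul0mx !mulmx1 !add0r add_col_mx scale_col_mx.
set y := invmx _ *m _.
have yE : 2^-1 *: (b false + b true) = y - 2^-1 *: (B false + B true) *m y.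
  have := mulKVmx (avg_unitmx B_cvg0) (2^-1 *: (b false + b true)).
  by rewrite -/y mulmxBl mul1mx => ->.
congr col_mx; last by rewrite scaler_nat mulr2n.
apply: (@scalerI _ _ 2^-1); first by rewrite invr_eq0 pnatr_eq0.
rewrite scalerA mulVf ?pnatr_eq0// scale1r addrACA -mulmxDl scalerDr yE.
by rewrite scalemxAl addrC subrK.
Qed.

(** The products A_v tend to phi(y) e, and e F = 1. *)
Let AF_cvg y : 0 <= y < 1 ->
  mxword A (pref k (bin y)) *m F @[k --> \oo] --> phi y.
Proof.
move=> y01; rewrite -[phi y]mulmx1 -eF -eE mulmxA.
apply: cvg_mulmx; last exact: cvg_cst.
exact: mxword_pref_cvg r _ y01.
Qed.

Lemma realization_normal_form : exists (A : wfa R (m + 1))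
    (B : bool -> 'M[R]_m) (b : bool -> 'cV[R]_m),
  [/\ minimal A, average_preserving A,
      (forall i, trans A i = block_mx (B i) (b i) 0 1%:M),
      stable B & computes A f].
Proof.
exists (Wfa I F A), B, b; split=> //=.
- split.
    apply: lspan_rV_full => M M0; apply: (rz_reach r) => u.
    by apply: M0; exists u.
  (* If M kills every A_v F, it kills their limits phi(x_j), hence the invertible evaluation
     matrix. *)
  apply: lspan_cV_full => M M0; apply: (realization_eval r).
  rewrite mul_eval_mx; apply/matrixP => i j; rewrite mxE.
  suff -> : M *m phi (x j) = 0 by rewrite !mxE.
  apply: (@cvg_unique _ _
    ((fun k => M *m (mxword A (pref k (bin (x j))) *m F)) @ \oo)).
  - exact: norm_hausdorff.
  - apply: cvg_mulmx; first exact: cvg_cst.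
    exact: AF_cvg (rz_itv r j).
  - rewrite (_ : (fun k => _) = fun=> 0); first exact: cvg_cst.
    by apply/funext => k; apply: M0; exists (pref k (bin (x j))).
- by move=> w; apply: cvg_comp B_cvg0; exact: pref_long_words.
- move=> y; rewrite in_itv /= => y01.
  have /cvg_mxP/(_ 0 0) : I *m (mxword A (pref k (bin y)) *m F) @[k --> \oo] -->
      I *m phi y.
    by apply: cvg_mulmx; [exact: cvg_cst|exact: AF_cvg].
  rewrite (rz_init r)// mxE eqxx mulr1n; apply: cvg_trans.
  apply: near_eq_cvg; near=> k.
  by rewrite /Defs.approx /= mulmxA.
Unshelve. all: by end_near. Qed.

End normal_form.

Theorem corollary59 (R : realType) (f : R -> R)
    (f_nonzero : exists2 x, x \in `[0, 1[ & f x != 0)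
    (f_unif : unif_continuous (f : subspace `[0, 1[%classic -> R))
    (f_wfa : exists (n : nat) (A : wfa R n), computes A f) :
  exists (m : nat) (A : wfa R (m + 1))
         (B : bool -> 'M[R]_m) (b : bool -> 'cV[R]_m),
    [/\ minimal A,
        average_preserving A,
        (forall i : bool, trans A i = block_mx (B i) (b i) 0 1%:M),
        stable B
      & computes A f].
Proof.
have [n [A0 A0f]] := f_wfa.
have [p [phi [I [A [x r]]]]] := computes_realization f_unif A0f.
(* This row pairs to 1 with phi(0). *)
have e0 : const_mx 1 *m invmx (eval_mx phi x) != 0 :> 'rV[R]_p.
  apply/eqP => e0; have := realization_const r f_nonzero (y := 0).
  rewrite lexx ltr01 e0 mul0mx => /(_ isT)/matrixP/(_ 0 0)/eqP.
  by rewrite !mxE eqxx eq_sym oner_eq0.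
have [m [Q [pE]]] := row_complement e0.
subst p => Qfull; exists m.
have Su : col_mx Q (const_mx 1 *m invmx (eval_mx phi x)) \in unitmx.
  by rewrite -row_full_unit.
apply: (realization_normal_form (realization_basis r Su)) => //.
(* It remains to see that the constant 1 has coordinates (0 1) in the new basis, whose last element
   it is. *)
apply: (can_inj (mulmxK (rz_unit (realization_basis r Su)))).
rewrite mulmxKV ?(rz_unit (realization_basis r Su))//.
rewrite -mul_eval_mx mulmxA mul_row_col mul0mx mul1mx add0r mulmxKV//.
exact: rz_unit r.
Qed.
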